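(* Let $I=\{1,\ldots,l\}$, $J=\{l+1,\ldots,m\}$, let $f_k\colon\mathcal{H}\to\mathbb{R}$, $k\in\{0\}\cup I\cup J$, be DC functions, and consider the problem $$\min_{x \in \mathcal{H}} f_0(x) \quad \text{s.t.} \quad f_i(x) \le 0, \ i \in I, \quad f_j(x) = 0, \ j \in J, \qquad (\mathcal{P}_{IJ})$$ with feasible region $\Omega$. Let $$\varphi(x) = \sum_{i = 1}^l \max\{ 0, f_i(x) \} + \sum_{j = l + 1}^m |f_j(x)|,\qquad F_\lambda(x)=f_0(x)+\lambda\varphi(x).$$ Let $\mathcal{H}$ be finite dimensional. Suppose that $\varphi$ has a local error bound at every globally optimal solution of $(\mathcal{P}_{IJ})$, i.e. for any globally optimal solution $x_*$ of this problem there exist $\tau > 0$ and a neighbourhood $U$ of $x_*$ such that $$\varphi(x) \ge \tau \operatorname{dist}(x, \Omega) \quad \forall x \in U.$$ Then the function $F_{\lambda}$ is globally exact if and only if there exists $\lambda \ge 0$ such that the set $\{ x \in \mathcal{H} \mid F_{\lambda}(x) < f_* \}$ is either bounded or empty, where $f_*$ is the optimal value of $(\mathcal{P}_{IJ})$. In particular, $F_{\lambda}$ is globally exact, provided this function is bounded below for some $\lambda \ge 0$, and the set $$C_{\alpha} = \{ x \in \mathcal{H} \mid f_0(x) < f_* + \alpha, \: f_i(x) < \alpha, \: i \in I, \: |f_j(x)| < \alpha, \: j \in J \}$$ is bounded for some $\alpha > 0$.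
   Context: $\mathcal{H}$ is a real Hilbert space. A DC function is a finite-valued function $f\colon\mathcal{H}\to\mathbb{R}$ of the form $f=g-h$ with $g,h\colon\mathcal{H}\to\mathbb{R}$ closed (lower semicontinuous) convex functions. $\operatorname{dist}(x,\Omega)=\inf_{y\in\Omega}\|x-y\|$. The (penalty) function $F_{\lambda}$ is said to be globally exact for the problem $(\mathcal{P}_{IJ})$ if there exists $\lambda_* \ge 0$ such that for any $\lambda \ge \lambda_*$ the set of globally optimal solutions of $(\mathcal{P}_{IJ})$ coincides with the set of global minimizers of $F_{\lambda}$ over $\mathcal{H}$.
   Formalization: The feasible region is assumed nonempty, and the ''only if'' part is stated when a globally optimal solution exists (without these the claim is false); the ''if'' and ''in particular'' parts need only a nonempty feasible region. *)

(* Defs.v *)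
From HB Require Import structures.
From mathcomp Require Import all_boot all_order all_algebra.
From mathcomp Require Import all_classical all_reals all_analysis.

Set Implicit Arguments.
Unset Strict Implicit.
Unset Printing Implicit Defensive.

Import Order.TTheory GRing.Theory Num.Theory.
Import numFieldNormedType.Exports.

Local Open Scope classical_set_scope.
Local Open Scope ring_scope.

Definition finite_dimensional (R : realType) (H : lmodType R) : Prop :=
  exists (n : nat) (e : 'I_n -> H),
    forall x : H, exists c : 'I_n -> R, x = \sum_(i < n) c i *: e i.

Definition closed_convex (R : realType) (H : normedModType R) (g : H -> R) : Prop :=
  lower_semicontinuous (fun x => (g x)%:E) /\
  convex_function (setT : set (convex_lmodType H)) g.

Definition dc_function (R : realType) (H : normedModType R) (f : H -> R) : Prop :=
  exists g h : H -> R,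
    [/\ closed_convex g, closed_convex h & forall x, f x = g x - h x].

(* Extended-real valued: the distance to the empty set is +oo. *)
Definition dist (R : realType) (H : normedModType R) (x : H) (A : set H) : \bar R :=
  ereal_inf [set `|x - y|%:E | y in A].

Definition global_minimizers (R : realType) (H : normedModType R) (F : H -> R) :
    set H :=
  [set x | forall y, F x <= F y].

(* The problem data are [f 0] (objective), [f 1], ..., [f l] (inequality
   constraints) and [f l.+1], ..., [f m] (equality constraints); the values of
   [f] at indices above [m] are irrelevant. *)
Section Problem.
Variables (R : realType) (H : normedModType R) (l m : nat) (f : nat -> H -> R).

Definition feasible : set H :=
  [set x | (forall i, (1 <= i <= l)%N -> f i x <= 0) /\
           (forall j, (l.+1 <= j <= m)%N -> f j x = 0)].

Definition optimal_solutions : set H :=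
  [set x | feasible x /\ forall y, feasible y -> f 0%N x <= f 0%N y].

Definition optimal_value : \bar R :=
  ereal_inf [set (f 0%N x)%:E | x in feasible].

Definition penalty_term (x : H) : R :=
  \sum_(1 <= i < l.+1) Num.max 0 (f i x) + \sum_(l.+1 <= j < m.+1) `|f j x|.

Definition penalty_function (lambda : R) (x : H) : R :=
  f 0%N x + lambda * penalty_term x.

Definition globally_exact : Prop :=
  exists2 lambda0 : R, 0 <= lambda0 &
    forall lambda, lambda0 <= lambda ->
      optimal_solutions = global_minimizers (penalty_function lambda).

Definition local_error_bound (x0 : H) : Prop :=
  exists2 tau : R, 0 < tau &
    \forall x \near x0, (tau%:E * dist x feasible <= (penalty_term x)%:E)%E.

Definition below_optimal_value (lambda : R) : set H :=
  [set x | ((penalty_function lambda x)%:E < optimal_value)%E].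

Definition nearly_optimal (alpha : R) : set H :=
  [set x | [/\ ((f 0%N x)%:E < optimal_value + alpha%:E)%E,
               forall i, (1 <= i <= l)%N -> f i x < alpha
             & forall j, (l.+1 <= j <= m)%N -> `|f j x| < alpha]].

End Problem.

(* Main.v *)
(* By Baire's theorem a closed convex function is bounded above on some ball,
   hence, by convexity, near every point, hence it is Lipschitz near every
   point; so DC functions are locally Lipschitz.  Near a point p and for large
   mu one has F_mu >= f_*: if p is infeasible because phi(p) > 0, if p is
   feasible but not optimal because then f_0 > f_* near p, and if p is optimal
   because moving from x to a nearby feasible point changes f_0 by at most
   L dist(x, Omega) <= (L / tau) phi(x).  If the sublevel set
   {F_lambda < f_*} is bounded, it lies in a compact set, and covering this
   set by such neighbourhoods gives one mu with F_mu >= f_* everywhere; exactness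
   holds beyond mu. *)

Require Import Defs.
From HB Require Import structures.
From mathcomp Require Import all_boot all_order all_algebra.
From mathcomp Require Import all_classical all_reals all_analysis.
From mathcomp Require Import lra ring.

Set Implicit Arguments.
Unset Strict Implicit.
Unset Printing Implicit Defensive.

Import Order.TTheory GRing.Theory Num.Theory.
Import numFieldNormedType.Exports.

Local Open Scope classical_set_scope.
Local Open Scope ring_scope.

(** * Local boundedness and local Lipschitz continuity of convex and DC functions *)

Lemma closed_convex_le (R : realType) (H : normedModType R) (g : H -> R) :
  closed_convex g -> forall (t : R) (x y : H), 0 <= t <= 1 ->
  g (t *: x + (1 - t) *: y) <= t * g x + (1 - t) * g y.
Proof.
move=> [_ cg] t x y /andP[t0 t1].
have xT (z : H) : (z : convex_lmodType H) \in [set: convex_lmodType H].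
  by rewrite inE.
have := cg (Itv01 t0 t1) x y (xT x) (xT y).
by [].
Qed.

Section convex.
Variables (R : realType) (H : completeNormedModType R).
Implicit Types (f g : H -> R) (x y : H).

Lemma closed_convex_ubounded_near g x0 : closed_convex g ->
  exists M : R, \forall x \near x0, g x <= M.
Proof.
move=> cg; have [lscg _] := cg.
pose O n := [set x : H | n%:R < g x].
have openO n : open (O n).
  have := (lower_semicontinuousP _).1 lscg n%:R.
  by congr open; apply/seteqP; split=> x; rewrite /= lte_fin.
(* The sets [O n] have empty intersection because [g] is finite-valued, so by Baire they are not all
   dense; on an open set that misses [O n], [g] is at most [n]. *)
have [n ndO] : exists n, ~ dense (O n).
  apply: contrapT => /forallNP dO.
  have /(_ setT) : dense (\bigcap_i (O i)).
    by apply: Baire => i; split=> //; apply: contrapT; exact: dO.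
  case; [by exists x0 | exact: openT |].
  move=> x [_ Ox]; have := Ox (Num.truncn (g x)).+1 I.
  rewrite /O /= => /ltW; apply/negP; rewrite -ltNge.
  exact: truncnS_gt.
have /existsNP[D /not_implyP[[a Da] /not_implyP[oD D0]]] := ndO.
have gD x : D x -> g x <= n%:R.
  by move=> Dx; rewrite leNgt; apply/negP => Ox; apply: D0; exists x.
(* [b] is the reflection of [a] in [x0]. Each [x] is the midpoint of [b] and [2 *: x - b], and the
   latter is close to [a], hence in [D], once [x] is close to [x0]. *)
pose b := 2 *: x0 - a.
exists (2^-1 * n%:R + (1 - 2^-1) * g b).
have cvg2 : (2 *: x - b) @[x --> x0] --> a.
  rewrite -[X in _ --> X](_ : 2 *: x0 - b = a); last by rewrite /b subKr.
  by apply: cvgB; [apply: cvgZl_tmp; exact: cvg_id | exact: cvg_cst].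
have : \forall x \near x0, D (2 *: x - b).
  by apply: cvg2; apply: open_nbhs_nbhs.
apply: filterS => x Dx.
have h2 : 0 <= (2^-1 : R) <= 1 by apply/andP; split; lra.
have := closed_convex_le cg (2 *: x - b) b h2.
have -> : 2^-1 *: (2 *: x - b) + (1 - 2^-1) *: b = x.
  have -> : 1 - 2^-1 = 2^-1 :> R by lra.
  by rewrite -scalerDr subrK scalerA mulVf ?scale1r.
move=> /le_trans; apply; rewrite lerD2r ler_pM2l ?invr_gt0 //; exact: gD.
Qed.

(** An upper bound on a ball yields a two-sided bound [B] there. By convexity the slope from [x] to
    [y] is at most the slope from [x] to a point [z] beyond [y], hence at most [2 * B] divided by
    [r / 2]. *)
Lemma closed_convex_lipschitz_near g x0 : closed_convex g ->
  exists L : R, \forall x \near x0 & y \near x0, `|g x - g y| <= L * `|x - y|.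
Proof.
move=> cg; have [M /nbhs_ballP[r /= r0 Mr]] := closed_convex_ubounded_near x0 cg.
(* Since [x0] is the midpoint of [x] and [2 *: x0 - x], the upper bound at the reflected point
   bounds [g x] from below. *)
have gbound x : ball x0 r x -> `|g x| <= `|M| + 2 * `|g x0|.
  move=> x0x.
  have x0x' : ball x0 r (2 *: x0 - x).
    move: x0x; rewrite -ball_normE /= scaler_nat mulr2n opprB opprD addrCA.
    by rewrite addNKr distrC.
  have h2 : 0 <= (2^-1 : R) <= 1 by apply/andP; split; lra.
  have := closed_convex_le cg x (2 *: x0 - x) h2.
  have -> : 2^-1 *: x + (1 - 2^-1) *: (2 *: x0 - x) = x0.
    have -> : 1 - 2^-1 = 2^-1 :> R by lra.
    by rewrite -scalerDr addrC subrK scalerA mulVf ?scale1r.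
  have := Mr _ x0x; have := Mr _ x0x' => /=.
  have := ler_norm M; have := ler_norm (g x0); have := ler_norm (- g x0).
  have := normr_ge0 (g x0); have := normr_ge0 M.
  rewrite normrN; have -> : 1 - 2^-1 = 2^-1 :> R by lra.
  move=> *; rewrite ler_norml; lra.
pose B := `|M| + 2 * `|g x0|.
have B0 : 0 <= B by rewrite /B addr_ge0 // mulr_ge0.
(* Extend the segment from x to y beyond y by length r / 2. *)
have half x y : ball x0 (r / 2) x -> ball x0 (r / 2) y ->
    g y - g x <= 4 * B / r * `|x - y|.
  move=> xb yb; have [->|xy] := eqVneq x y.
    by rewrite !subrr normr0 mulr0.
  have d0 : 0 < `|y - x| by rewrite normr_gt0 subr_eq0 eq_sym.
  set d := `|y - x| in d0 *.
  pose z := y + (r / 2 / d) *: (y - x).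
  have bw w : ball x0 (r / 2) w -> ball x0 r w.
    by apply: le_ball; lra.
  have zb : ball x0 r z.
    move: yb; rewrite -ball_normE /= => yb.
    rewrite /z opprD addrA (le_lt_trans (ler_normB _ _)) //.
    have -> : `|(r / 2 / d) *: (y - x)| = r / 2.
      rewrite normrZ ger0_norm ?divr_ge0 ?(ltW r0) ?(ltW d0) //.
      by rewrite divfK // gt_eqF.
    lra.
  (* [y] divides the segment from [x] to [z] in the ratio [d] to [r / 2], so [t] is the weight of
     [z]. *)
  pose t := d / (d + r / 2).
  have dr : 0 < d + r / 2 by lra.
  have t1 : 0 <= 1 - t <= 1.
    have : 0 <= t by rewrite divr_ge0 // ltW.
    have : t <= 1 by rewrite ler_pdivrMr // mul1r; lra.
    by move=> *; apply/andP; split; lra.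
  have ty : (1 - t) *: x + (1 - (1 - t)) *: z = y.
    rewrite subKr /z scalerDr scalerA.
    have -> : t * (r / 2 / d) = 1 - t.
      by rewrite /t; field; apply/andP; split; rewrite gt_eqF //; lra.
    by rewrite addrCA -scalerDr (addrC x) subrK -scalerDl addrC subrK scale1r.
  have := closed_convex_le cg x z t1; rewrite ty subKr => gy.
  have := gbound _ (bw _ xb); have := gbound _ zb; rewrite -/B !ler_norml.
  move=> /andP[_ gz] /andP[gx _].
  have tB : t <= 2 * d / r.
    rewrite /t ler_pdivrMr //.
    have -> : 2 * d / r * (d + r / 2) = 2 * d * d / r + d.
      by field; rewrite gt_eqF.
    by rewrite lerDr divr_ge0 ?(ltW r0) // !mulr_ge0 ?(ltW d0).
  have : t * (2 * B) <= 2 * d / r * (2 * B).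
    by rewrite ler_wpM2r // mulr_ge0.
  have -> : 2 * d / r * (2 * B) = 4 * B / r * `|x - y|.
    by rewrite distrC -/d; ring.
  apply: le_trans.
  have : t * (g z - g x) <= t * (2 * B).
    by rewrite ler_wpM2l ?divr_ge0 ?(ltW d0) ?(ltW dr) //; lra.
  lra.
exists (4 * B / r).
have r2 : 0 < r / 2 by rewrite divr_gt0.
exists (ball x0 (r / 2), ball x0 (r / 2)) => /=.
  by split; exact: nbhsx_ballx.
move=> [x y] /= [xb yb]; rewrite ler_norml; apply/andP; split.
  by have := half x y xb yb; lra.
by have := half y x yb xb; rewrite (distrC y); lra.
Qed.

Lemma dc_lipschitz_near f x0 : dc_function f ->
  exists L : R, \forall x \near x0 & y \near x0, `|f x - f y| <= L * `|x - y|.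
Proof.
move=> [g [h [cg ch fE]]].
have [K gK] := closed_convex_lipschitz_near x0 cg.
have [L hL] := closed_convex_lipschitz_near x0 ch.
exists (K + L); apply: filterS2 gK hL => -[x y] /= gxy hxy.
rewrite !fE mulrDl; apply: le_trans (lerD gxy hxy).
have -> : g x - h x - (g y - h y) = (g x - g y) - (h x - h y) by ring.
exact: ler_normB.
Qed.

Lemma dc_continuous f : dc_function f -> continuous f.
Proof.
move=> dcf x0; have [L [[A B] /= [Ax Bx] AB]] := dc_lipschitz_near x0 dcf.
have : (L * `|x - x0|) @[x --> x0] --> (0 : R).
  rewrite -[X in _ --> X](mulr0 L) -(normr0 H) -(subrr x0).
  by apply: cvgMr; apply: cvg_norm; apply: cvgB; [exact: cvg_id|exact: cvg_cst].
move=> /(@cvgrPdist_lt _ R^o) cvgL; apply/(@cvgrPdist_lt _ R^o) => e e0.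
have := cvgL e e0; apply: filterS2 Ax => x Ax; rewrite sub0r normrN => xe.
rewrite distrC; apply: le_lt_trans xe; apply: le_trans (ler_norm _).
exact: (AB (x, x0) (conj Ax (nbhs_singleton Bx))).
Qed.

End convex.

(** * Bounded sets in a finite-dimensional inner product space *)

Section heine_borel.
Variables (R : realType) (H : normedModType R) (ip : {dot H for idfun}).
Hypothesis norm_ip : forall x : H, `|x| ^+ 2 = ip x x.

Let ipC (x y : H) : ip x y = ip y x.
Proof. by rewrite (hermC ip x y) expr0 mul1r. Qed.

Let ipDl (x y z : H) : ip (x + y) z = ip x z + ip y z.
Proof. exact: linearDl. Qed.

Let ipZl (a : R) (x y : H) : ip (a *: x) y = a * ip x y.
Proof. exact: linearZl_LR. Qed.

Let ip0l (y : H) : ip 0 y = 0. Proof. exact: linear0l. Qed.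

Let ipNl (x y : H) : ip (- x) y = - ip x y. Proof. exact: linearNl. Qed.

Let ipDr (x y z : H) : ip z (x + y) = ip z x + ip z y.
Proof. exact: linearDr. Qed.

Let ipZr (a : R) (x y : H) : ip y (a *: x) = a * ip y x.
Proof. exact: linearZr_LR. Qed.

Let ipNr (x y : H) : ip y (- x) = - ip y x. Proof. exact: linearNr. Qed.

Let ip_suml (bs : seq H) (c : H -> R) (y : H) :
  ip (\sum_(v <- bs) c v *: v) y = \sum_(v <- bs) c v * ip v y.
Proof.
elim: bs => [|v bs IHo]; first by rewrite !big_nil ip0l.
by rewrite !big_cons ipDl ipZl IHo.
Qed.

Let ip_sumr (bs : seq H) (c : H -> R) (y : H) :
  ip y (\sum_(v <- bs) c v *: v) = \sum_(v <- bs) c v * ip y v.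
Proof. by rewrite ipC ip_suml; apply: eq_bigr => v _; rewrite ipC. Qed.

(** Removing from [x] its projection on [u] leaves a vector whose squared norm is the square of
    [|x|] minus that of [ip x u]. *)
Lemma ip_unit_le (x u : H) : `|u| = 1 -> `|ip x u| <= `|x|.
Proof.
move=> u1; have : 0 <= ip (x - ip x u *: u) (x - ip x u *: u).
  by rewrite -norm_ip sqr_ge0.
rewrite ipDl !ipNl ipZl !ipDr !ipNr !ipZr /=.
rewrite (ipC u x) -!norm_ip u1 => h.
rewrite -(@ler_pXn2r _ 2) ?nnegrE // real_normK ?num_real //.
by move: h; lra.
Qed.

(** Gram-Schmidt with the expansion property, demanded of [bs] as well, in place of pairwise
    orthogonality: expanding [x] in [ip x e] shows that the residue [r] of a new vector [e] is
    orthogonal to all of [s ++ bs]. *)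
Lemma gram_schmidt (s : seq H) : exists bs : seq H,
  {in bs, forall v, `|v| = 1} /\
  {in s ++ bs, forall x, x = \sum_(v <- bs) ip x v *: v}.
Proof.
elim: s => [|e s [bs [bs1 bsE]]]; first by exists [::].
pose r := e - \sum_(v <- bs) ip e v *: v.
have [req0|r0] := eqVneq r 0.
  exists bs; split=> // x; rewrite inE => /orP[/eqP ->|]; last exact: bsE.
  by apply/eqP; rewrite -subr_eq0 -/r req0.
have ortho x : x \in s ++ bs -> ip x r = 0.
  move=> /bsE xE; rewrite ipDr ipNr ip_sumr {1}xE ip_suml.
  apply/eqP; rewrite subr_eq0; apply/eqP; apply: eq_bigr => v _.
  by rewrite (ipC v) mulrC.
have nr0 : `|r| != 0 by rewrite normr_eq0.
pose u := `|r|^-1 *: r.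
have u1 : `|u| = 1 by rewrite normrZ normfV normr_id mulVf.
have er : ip e r = `|r| ^+ 2.
  rewrite norm_ip {2}/r ipDl ipNl ip_suml big_seq big1 ?subr0 //.
  by move=> v vo; rewrite ortho ?mulr0 // mem_cat vo orbT.
have xu x : x \in s ++ bs -> ip x u = 0.
  by move=> /ortho xr; rewrite ipZr xr mulr0.
exists (u :: bs); split=> [v|x].
  by rewrite inE => /orP[/eqP ->|/bs1].
rewrite big_cons inE mem_cat inE [X in _ || X]orbCA.
rewrite -mem_cat => /orP[/eqP ->|/orP[/eqP ->|xso]]; last first.
- by rewrite xu // scale0r add0r; exact: bsE.
- rewrite -norm_ip u1 expr1n scale1r big_seq big1 ?addr0 // => v vo.
  by rewrite ipC xu ?scale0r // mem_cat vo orbT.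
- have -> : ip e u *: u = r.
    by rewrite /u ipZr er scalerA expr2 mulKf // mulfV // scale1r.
  by rewrite subrK.
Qed.

(** The coordinates [ip x v] along unit vectors are bounded by the norm of [x], so [A] lies in the
    image of a cube under the continuous map from coordinates to vectors. *)
Lemma bounded_sub_compact (A : set H) : finite_dimensional H ->
  bounded_set A -> exists2 K, compact K & A `<=` K.
Proof.
move=> [n [e spanH]] bA.
have [bs [bs1 bsE]] := gram_schmidt [seq e i | i : 'I_n].
have xE x : x = \sum_(v <- bs) ip x v *: v.
  have [c ->] := spanH x.
  (* [W] is stable under linear combinations and contains every [e i]. *)
  pose W := [set y | y = \sum_(v <- bs) ip y v *: v].
  rewrite -/(W _); apply: (big_ind W) => [|y z Wy Wz|i _].
  - by rewrite /W /= big1 // => v _; rewrite ip0l scale0r.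
  - rewrite /W /= {1}Wy {1}Wz -big_split /=; apply: eq_bigr => v _.
    by rewrite ipDl scalerDl.
  - rewrite /W /= {1}[e i]bsE; last by rewrite mem_cat map_f // mem_enum.
    by rewrite scaler_sumr; apply: eq_bigr => v _; rewrite ipZl scalerA.
pose F (c : 'rV[R]_(size bs)) := \sum_(i < size bs) c ord0 i *: bs`_i.
have [M [_ bM]] := bA.
(* Boundedness provides every bound strictly above [M], whence [M + 1]. *)
pose B := [set c : 'rV[R]_(size bs) | forall i, c ord0 i \in `[- (M + 1), M + 1]].
have cB : compact B.
  apply: (@rV_compact _ _ (fun=> `[- (M + 1), M + 1]%classic)).
  by move=> _; exact: segment_compact.
exists (F @` B).
  apply: continuous_compact cB; apply: continuous_subspaceT.
  apply: (@continuous_big H _ +%R 0 xpredT (@add_continuous H)) => i _ c.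
  exact: (@cvgZr_tmp R H _ (nbhs c) _ (fun v : 'rV[R]_(size bs) => v ord0 i)
    _ _ (@coord_continuous R 1 (size bs) ord0 i c)).
move=> x Ax; exists (\row_i ip x bs`_i).
  move=> i; rewrite mxE in_itv /= -ler_norml.
  apply: le_trans (ip_unit_le _ _) _; first by rewrite bs1 // mem_nth.
  by apply: bM Ax; rewrite ltrDl.
rewrite /F [RHS]xE (big_nth 0) big_mkord.
by apply: eq_bigr => i _; rewrite mxE.
Qed.

End heine_borel.

(** * The penalty term and local lower bounds for the penalty function *)

Section penalty.
Variables (R : realType) (H : normedModType R) (l m : nat) (f : nat -> H -> R).
Local Notation Omega := (feasible l m f).
Local Notation phi := (penalty_term l m f).
Local Notation F := (penalty_function l m f).
Local Notation fstar := (optimal_value l m f).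

Lemma penalty_term_ge0 x : 0 <= phi x.
Proof.
by rewrite addr_ge0 ?sumr_ge0 // => i _; rewrite le_max lexx.
Qed.

Lemma ineq_le_penalty_term x i : (1 <= i <= l)%N -> f i x <= phi x.
Proof.
move=> il; have iI : i \in index_iota 1 l.+1 by rewrite mem_index_iota ltnS.
rewrite /penalty_term (big_rem _ iI) /= -addrA.
have : 0 <= \sum_(j <- rem i (index_iota 1 l.+1)) Num.max 0 (f j x) +
   \sum_(l.+1 <= j < m.+1) `|f j x|.
  by rewrite addr_ge0 ?sumr_ge0 // => j _; rewrite le_max lexx.
by move=> rest0; rewrite ler_wpDr // le_max lexx orbT.
Qed.

Lemma eq_le_penalty_term x j : (l.+1 <= j <= m)%N -> `|f j x| <= phi x.
Proof.
move=> jm; have jI : j \in index_iota l.+1 m.+1 by rewrite mem_index_iota ltnS.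
rewrite /penalty_term (big_rem _ jI) /= addrCA.
have : 0 <= \sum_(1 <= i < l.+1) Num.max 0 (f i x) +
   \sum_(i <- rem j (index_iota l.+1 m.+1)) `|f i x|.
  by rewrite addr_ge0 ?sumr_ge0 // => i _; rewrite le_max lexx.
by move=> rest0; rewrite ler_wpDr.
Qed.

Lemma penalty_term_eq0 x : phi x = 0 <-> Omega x.
Proof.
split=> [phi0|[fle feq]].
  split=> [i /(ineq_le_penalty_term x)|j /(eq_le_penalty_term x)].
    by rewrite phi0.
  by rewrite phi0 normr_le0 => /eqP.
rewrite /penalty_term !big_nat !big1 ?addr0 // => [j|i].
  by rewrite ltnS => /feq ->; rewrite normr0.
by rewrite ltnS => /fle /max_l.
Qed.

Lemma penalty_function_feasible lambda x : Omega x -> F lambda x = f 0%N x.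
Proof.
by move=> /penalty_term_eq0 x0; rewrite /penalty_function x0 mulr0 addr0.
Qed.

Lemma penalty_function_mono x : {homo F ^~ x : s t / s <= t}.
Proof. by move=> s t st; rewrite lerD2l ler_wpM2r // penalty_term_ge0. Qed.

Lemma optimal_value_le x : Omega x -> (fstar <= (f 0%N x)%:E)%E.
Proof. by move=> Ox; apply: ereal_inf_lbound; exists x. Qed.

Lemma optimal_value_solution x :
  optimal_solutions l m f x -> fstar = (f 0%N x)%:E.
Proof.
move=> [Ox xmin]; apply/eqP; rewrite eq_le optimal_value_le //=.
by apply/ereal_infP => _ [y Oy <-]; rewrite lee_fin xmin.
Qed.

Lemma optimal_solutionP x : Omega x -> ((f 0%N x)%:E <= fstar)%E ->
  optimal_solutions l m f x.
Proof.
move=> Ox xle; split=> // y /optimal_value_le yge.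
by have := le_trans xle yge; rewrite lee_fin.
Qed.

(* An infeasible minimizer of F_lambda may have value f_*; it is excluded only
   beyond lambda, whence lambda + 1 in the proof. *)
Lemma globally_exact_below0 lambda : 0 <= lambda -> Omega !=set0 ->
  below_optimal_value l m f lambda = set0 -> globally_exact l m f.
Proof.
move=> l0 [w Ow] Sl0; exists (lambda + 1); first by rewrite addr_ge0.
move=> mu lmu.
have below x : (fstar <= (F lambda x)%:E)%E.
  rewrite leNgt; apply/negP => xl.
  by have : below_optimal_value l m f lambda x by []; rewrite Sl0.
have lemu : lambda <= mu by lra.
apply/seteqP; split=> x /=.
  move=> xopt y; have [Ox _] := xopt.
  rewrite penalty_function_feasible // -lee_fin -(optimal_value_solution xopt).
  by rewrite (le_trans (below y)) // lee_fin penalty_function_mono.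
move=> xmin.
have xf : ((F mu x)%:E <= fstar)%E.
  apply/ereal_infP => _ [y Oy <-].
  by rewrite lee_fin -(penalty_function_feasible mu Oy).
have Ox : Omega x.
  apply/penalty_term_eq0/eqP; rewrite eq_le penalty_term_ge0 andbT.
  have := le_trans xf (below x); rewrite lee_fin lerD2l => h.
  by rewrite leNgt; apply/negP => phi0; move: h; rewrite ler_pM2r // leNgt; lra.
by apply: optimal_solutionP => //; rewrite -(penalty_function_feasible mu Ox).
Qed.

Lemma penalty_term_continuous : (l <= m)%N ->
  (forall k, (k <= m)%N -> continuous (f k)) -> continuous phi.
Proof.
move=> lm cf x; rewrite /penalty_term.
apply: cvgD; rewrite big_nat; under eq_cvg do rewrite big_nat.
  apply: (@cvg_big R^o _ +%R 0 _ (@add_continuous R^o)) => i /andP[_ il].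
  apply: (@continuous_max _ _ (cst 0) (f i)); first exact: cvg_cst.
  by apply: cf; rewrite -ltnS (leq_trans il).
apply: (@cvg_big R^o _ +%R 0 _ (@add_continuous R^o)) => i /andP[_ im].
by apply: cvg_norm; exact: cf.
Qed.

(** The bound is joint in [x] and [mu], so that one threshold for [mu] serves a whole neighbourhood
    of [p]; this is what the covering form of compactness consumes. *)
Lemma penalty_function_ge_near (p : H) (fs : R) :
  fstar = fs%:E -> continuous phi -> {for p, continuous (f 0%N)} ->
  (exists L : R, \forall x \near p & y \near p,
     `|f 0%N x - f 0%N y| <= L * `|x - y|) ->
  (optimal_solutions l m f p -> local_error_bound l m f p) ->
  \forall x \near p & mu \near +oo, fs <= F mu x.
Proof.
move=> fsE cphi cf0 [L lipf0] eb.
have [Op|nOp] := pselect (Omega p); last first.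
  have phip : 0 < phi p.
    rewrite lt_neqAle penalty_term_ge0 andbT eq_sym.
    by apply/eqP => /penalty_term_eq0.
  (* On this neighbourhood [F mu x] is at least [f 0 p - 1 + mu * (phi p / 2)], and the threshold
     for [mu] makes this at least [fs]. *)
  exists ([set x | phi p / 2 < phi x] `&` [set x | f 0%N p - 1 < f 0%N x],
          [set mu | 0 <= mu /\ 2 * (fs - f 0%N p + 1) / phi p <= mu]) => /=.
    split; first apply: filterI.
    - by apply: (cvgr_gt _ (cphi p)); rewrite gtr_pMr // invf_lt1 // ltr1n.
    - by apply: (cvgr_gt _ cf0); rewrite gtrBl.
    - by apply: filterI; apply: nbhs_pinfty_ge; exact: num_real.
  move=> [x mu] /= [[xphi xf] [mu0 mup]]; rewrite /penalty_function.
  have : mu * (phi p / 2) <= mu * phi x by rewrite ler_wpM2l // ltW.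
  move: mup; rewrite ler_pdivrMr // => mup; lra.
have [fsp|fps] := ltP fs (f 0%N p).
  exists ([set x | fs < f 0%N x], [set mu | 0 <= mu]) => /=.
    by split; [exact: (cvgr_gt _ cf0) | apply: nbhs_pinfty_ge; exact: num_real].
  move=> [x mu] /= [xf mu0]; apply: le_trans (ltW xf) _.
  by rewrite lerDl mulr_ge0 // penalty_term_ge0.
have [|tau tau0 ebp] := eb.
  by apply: optimal_solutionP => //; rewrite fsE lee_fin.
have phip : phi p = 0 by apply/penalty_term_eq0.
case: lipf0 => -[A B] /= [pA pB] AB.
have /nbhs_ballP[r /= r0 rB] := pB.
(* A feasible [y] will be found within [2 * phi x / tau] of [x]. The bound on [phi x] makes this
   less than [r / 2], so [y] stays in [B], where the Lipschitz estimate applies; the threshold on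
   [mu] makes [mu * phi x] absorb the change of [f 0]. *)
exists (A `&` ball p (r / 2) `&` [set x | phi x < tau * r / 4]
   `&` [set x | (tau%:E * dist x Omega <= (phi x)%:E)%E],
   [set mu | 0 <= mu /\ 2 * `|L| / tau <= mu]) => /=.
  split; last by apply: filterI; apply: nbhs_pinfty_ge; exact: num_real.
  apply: filterI; last exact: ebp.
  apply: filterI; last first.
    by apply: (cvgr_lt _ (cphi p)); rewrite phip divr_gt0 // mulr_gt0.
  by apply: filterI => //; apply: nbhsx_ballx; rewrite divr_gt0.
move=> [x mu] /= [[[[xA xball] xphi] xdist] [mu0 muL]].
have [phix0|phix0] := eqVneq (phi x) 0.
  have Ox : Omega x by apply/penalty_term_eq0.
  by rewrite penalty_function_feasible // -lee_fin -fsE optimal_value_le.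
have phix : 0 < phi x by rewrite lt_neqAle eq_sym phix0 penalty_term_ge0.
(* The factor 2 gives strict room above the bound [phi x / tau] on the distance, because [phi x] is
   positive; no nearest point is required. *)
have [_ [y Oy <-]] : exists2 z, [set `|x - y|%:E | y in Omega] z &
    (z < (2 * phi x / tau)%:E)%E.
  apply: ereal_inf_lt; apply: (@le_lt_trans _ _ (tau^-1 * phi x)%:E).
    by rewrite EFinM lee_pdivlMl.
  by rewrite lte_fin mulrC ltr_pM2r ?invr_gt0 //; lra.
rewrite lte_fin => xy.
have yB : B y.
  apply: rB; move: xball; rewrite -ball_normE /= => px.
  have : `|p - y| <= `|p - x| + `|x - y|.
    by rewrite (le_trans _ (ler_normD _ _)) // addrA subrK.
  have : 2 * phi x / tau < r / 2.
    by rewrite ltr_pdivrMr //; move: xphi; rewrite mulrAC; lra.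
  by lra.
have := AB (x, y) (conj xA yB) => /= Lxy.
have : fs <= f 0%N y by rewrite -lee_fin -fsE optimal_value_le.
have : `|L| * `|x - y| <= mu * phi x.
  apply: (@le_trans _ _ (`|L| * (2 * phi x / tau))).
    by rewrite ler_wpM2l // ltW.
  rewrite (_ : _ * _ = 2 * `|L| / tau * phi x); last by ring.
  by rewrite ler_wpM2r // ltW.
have : L * `|x - y| <= `|L| * `|x - y| by rewrite ler_wpM2r // ler_norm.
move: Lxy; rewrite ler_norml /penalty_function => /andP[]; lra.
Qed.

End penalty.

(** * From local bounds to global exactness *)

Section exactness.
Variables (R : realType) (H : completeNormedModType R) (l m : nat).
Variable f : nat -> H -> R.
Hypotheses (le_lm : (l <= m)%N)
  (f_dc : forall k, (k <= m)%N -> dc_function (f k))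
  (error_bound : forall x0, optimal_solutions l m f x0 ->
     local_error_bound l m f x0).

(** Compactness gives one [mu] that works on all of [K]. Outside [K] the function for [lambda] is
    already at least the optimal value, and raising the parameter to [mu >= lambda] preserves
    this. *)
Lemma below_optimal_value_eq0 (K : set H) lambda : compact K ->
  feasible l m f !=set0 ->
  0 <= lambda -> below_optimal_value l m f lambda `<=` K ->
  exists2 mu, 0 <= mu & below_optimal_value l m f mu = set0.
Proof.
move=> cK [w Ow] l0 SK.
have : (optimal_value l m f < +oo)%E.
  by apply: le_lt_trans (optimal_value_le Ow) _; rewrite ltry.
case E : (optimal_value l m f) => [fs| |] // _; last first.
  (* If the optimal value is [-oo], no real value lies below it. *)
  exists 0 => //; apply/seteqP; split=> x //=.
  by rewrite /below_optimal_value /= E.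
have cf k : (k <= m)%N -> continuous (f k) by move=> /f_dc; exact: dc_continuous.
have cover : \forall mu \near +oo,
    K `<=` [set x | fs <= penalty_function l m f mu x].
  apply: ((compact_near_coveringP K).1 cK) => x _.
  apply: penalty_function_ge_near => //.
  - exact: penalty_term_continuous.
  - exact: cf.
  - exact: dc_lipschitz_near (f_dc _).
  - exact: error_bound.
have /filter_ex[mu [Kmu lmu]] : \forall mu \near +oo,
    K `<=` [set x | fs <= penalty_function l m f mu x] /\ lambda <= mu.
  by apply: filterI => //; apply: nbhs_pinfty_ge; exact: num_real.
exists mu; first exact: le_trans lmu.
apply/seteqP; split=> x //=; rewrite /below_optimal_value /= E lte_fin => xmu.
have /Kmu /= : K x.
  apply: SK; rewrite /below_optimal_value /= E lte_fin.
  exact: le_lt_trans (penalty_function_mono _ _ _ _ lmu) xmu.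
by rewrite leNgt xmu.
Qed.

End exactness.

(** Adding [(fs - c) / alpha] to [lambda] suffices: a point whose penalty term is at least [alpha]
    then has penalty function at least [c + (fs - c)], which is the optimal value [fs]. *)
Lemma below_sub_nearly_optimal (R : realType) (H : normedModType R) (l m : nat)
  (f : nat -> H -> R) (lambda c alpha : R) : 0 <= lambda -> 0 < alpha ->
  (forall x, c <= penalty_function l m f lambda x) -> feasible l m f !=set0 ->
  exists2 mu, 0 <= mu &
    below_optimal_value l m f mu `<=` nearly_optimal l m f alpha.
Proof.
move=> l0 a0 cF [w Ow].
have : (optimal_value l m f < +oo)%E.
  by apply: le_lt_trans (optimal_value_le Ow) _; rewrite ltry.
(* The penalty function agrees with [f 0] on feasible points, so [c] also bounds the optimal value,
   which is therefore real. *)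
have : (c%:E <= optimal_value l m f)%E.
  apply/ereal_infP => _ [y Oy <-].
  by rewrite lee_fin -(penalty_function_feasible lambda Oy).
case E : (optimal_value l m f) => [fs| |] //; rewrite lee_fin => cfs _.
have d0 : 0 <= (fs - c) / alpha by rewrite divr_ge0 ?subr_ge0 // ltW.
exists (lambda + (fs - c) / alpha); first by rewrite addr_ge0.
move=> x; rewrite /below_optimal_value /= E lte_fin => xbelow.
have phi0 := penalty_term_ge0 l m f x.
have phia : penalty_term l m f x < alpha.
  rewrite ltNge; apply/negP => aphi.
  have : (fs - c) / alpha * alpha <= (fs - c) / alpha * penalty_term l m f x.
    by rewrite ler_wpM2l.
  rewrite divfK ?gt_eqF //.
  by have := cF x; move: xbelow; rewrite /penalty_function mulrDl; lra.
rewrite /nearly_optimal /= E; split.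
- rewrite -EFinD lte_fin; move: xbelow; rewrite /penalty_function.
  have : 0 <= (lambda + (fs - c) / alpha) * penalty_term l m f x.
    by rewrite mulr_ge0 // addr_ge0.
  lra.
- by move=> i /(ineq_le_penalty_term m f x) /le_lt_trans; apply.
- by move=> j /(eq_le_penalty_term f x) /le_lt_trans; apply.
Qed.

Theorem theorem3 (R : realType) (H : completeNormedModType R)
    (ip : {dot H for idfun})
    (norm_ip : forall x : H, `|x| ^+ 2 = ip x x)
    (fin_dim : finite_dimensional H)
    (l m : nat) (le_lm : (l <= m)%N) (f : nat -> H -> R)
    (f_dc : forall k, (k <= m)%N -> dc_function (f k))
    (feasible_neq0 : feasible l m f !=set0)
    (error_bound : forall x0, optimal_solutions l m f x0 ->
       local_error_bound l m f x0) :
  [/\ (optimal_solutions l m f !=set0 ->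
         (globally_exact l m f <->
          exists2 lambda : R, 0 <= lambda &
            bounded_set (below_optimal_value l m f lambda) \/
            below_optimal_value l m f lambda = set0)),
      ((exists2 lambda : R, 0 <= lambda &
          bounded_set (below_optimal_value l m f lambda) \/
          below_optimal_value l m f lambda = set0) ->
         globally_exact l m f)
    & ((exists2 lambda : R, 0 <= lambda &
          exists c : R, forall x, c <= penalty_function l m f lambda x) ->
       (exists2 alpha : R, 0 < alpha &
          bounded_set (nearly_optimal l m f alpha)) ->
         globally_exact l m f)].
Proof.
(* Used twice: with [A] the sublevel set itself, and with [A] the set of nearly optimal points. *)
have exact_of_bounded (A : set H) lambda : 0 <= lambda -> bounded_set A ->
    below_optimal_value l m f lambda `<=` A -> globally_exact l m f.
  move=> l0 bA SA; have [K cK AK] := bounded_sub_compact norm_ip fin_dim bA.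
  have [mu mu0 mu_empty] := below_optimal_value_eq0 le_lm f_dc error_bound cK
    feasible_neq0 l0 (subset_trans SA AK).
  exact: globally_exact_below0 mu0 feasible_neq0 mu_empty.
have exact_if : (exists2 lambda : R, 0 <= lambda &
    bounded_set (below_optimal_value l m f lambda) \/
    below_optimal_value l m f lambda = set0) -> globally_exact l m f.
  move=> [lambda l0 [bS|S0]]; first exact: exact_of_bounded l0 bS _.
  exact: globally_exact_below0 l0 feasible_neq0 S0.
split=> //.
(* By exactness [x0] minimizes the penalty function, whose value there is the optimal value, so
   nothing lies below. Without an optimal solution, exactness says only that minimizers are absent
   for large parameters, and the sublevel sets may all be unbounded. *)
- move=> [x0 x0opt]; split=> // -[lambda l0 exact_lambda].
  exists lambda => //; right; apply/seteqP; split=> x //=.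
  rewrite /below_optimal_value /= (optimal_value_solution x0opt) lte_fin ltNge.
  have [Ox0 _] := x0opt; rewrite -(penalty_function_feasible lambda Ox0).
  by move=> /negP; apply; move: x0opt; rewrite (exact_lambda _ (lexx _)); exact.
- move=> [lambda l0 [c cF]] [alpha a0 bC].
  have [mu mu0 subC] := below_sub_nearly_optimal l0 a0 cF feasible_neq0.
  exact: exact_of_bounded mu0 bC subC.
Qed.
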